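(* Let $m$ be a positive integer and let $\alpha_1,\dots,\alpha_k$ be positive irrational numbers satisfying $\sum_{i=1}^{k} \frac{1}{\alpha_i} = m$. Then the family $\{S(\alpha_1,0),\dots,S(\alpha_k,0)\}$ is an $m$-EEC if and only if $k$ is even, say $k=2l$, and the $\alpha_i$ can be re-ordered so that $$\frac{1}{\alpha_{2i-1}} + \frac{1}{\alpha_{2i}} \in \mathbb{Z}, \qquad i=1,\dots,l.$$
   Context: $\mathbb{N}$ denotes the set of positive integers. For real $\alpha>0$ and real $\beta$, the Beatty sequence $S(\alpha,\beta)$ is the multiset $\{\lfloor n\alpha+\beta\rfloor : n\in\mathbb{N}\}$ (an integer is counted as many times as it occurs). A finite family of multisets of integers is an $m$-EEC (eventual exact $m$-cover) if every sufficiently large positive integer occurs exactly $m$ times in the multiset union of the family, counting multiplicities. *)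

(* Defs.v *)
From mathcomp Require Import all_boot all_order all_algebra finmap perm.
From mathcomp Require Import boolp classical_sets functions cardinality reals.

Set Implicit Arguments.
Unset Strict Implicit.
Unset Printing Implicit Defensive.

Import Order.TTheory GRing.Theory Num.Theory.

Local Open Scope classical_set_scope.
Local Open Scope ring_scope.

(* A multiset of integers is represented by its multiplicity function; the
   multiset union of a family adds the multiplicities. *)
Definition imultiset := int -> nat.

Definition munion (k : nat) (F : 'I_k -> imultiset) : imultiset :=
  fun z => (\sum_(i < k) F i z)%N.

Definition beatty_index (R : realType) (alpha beta : R) (z : int) : set nat :=
  [set n : nat | (0 < n)%N /\ Num.floor (n%:R * alpha + beta) = z].

(* fset_set returns the empty set on infinite sets; this never happens
   here when 0 < alpha, see finite_beatty_index. *)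
Definition beatty (R : realType) (alpha beta : R) : imultiset :=
  fun z => #|` fset_set (beatty_index alpha beta z) |%fset.

Lemma finite_beatty_index (R : realType) (alpha beta : R) (z : int) :
  0 < alpha -> finite_set (beatty_index alpha beta z).
Proof.
move=> alpha_gt0; set b := ((z + 1)%:~R - beta) / alpha.
apply: (@sub_finite_set _ _ `I_(Num.bound `|b|)); last exact: finite_II.
move=> n [_ nz] /=.
have nlt : n%:R < b.
  by rewrite /b ltr_pdivlMr// ltrBrDr -nz floorD1_gt.
rewrite -(ltr_nat R); apply: (lt_le_trans nlt).
apply: le_trans (ler_norm _) _; apply: ltW.
by apply: archi_boundP.
Qed.

Definition is_EEC (m k : nat) (F : 'I_k -> imultiset) : Prop :=
  exists N : nat, forall x : nat, (N <= x)%N -> munion F x%:Z = m.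

(* Main.v *)
(* Put a_i = 1 / alpha_i. For x > 0 the integer x occurs floor((x+1) a_i) -
   floor(x a_i) times in S(alpha_i, 0), so the family is an m-EEC iff the
   sum over i of saw(x a_i) is eventually constant in x, where saw(t) = {t}
   - 1/2. Since saw is odd off the integers, complementary pairs contribute
   0.

   Conversely, choose a among the a_i that is not congruent mod 1 to n a_j
   for any j and any |n| > 1, and correlate the constant sum with sin(2 pi x
   a). The term saw(x b) has frequencies in Z b only, so it correlates with
   sin(2 pi x a) only if a is in Z b + Z, that is, by the choice of a, only
   if a = b or a = -b mod 1. If no a_j were congruent to -a, the surviving
   terms would all equal saw(x a) sin(2 pi x a), which is nonpositive and
   has nonzero mean, a contradiction. Hence some a_j is complementary to a;
   remove the pair and induct.

   In place of Fourier series, the vanishing of the correlations follows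
   from shifting x by y such that y b is nearly an integer and y a is not;
   such y exist by a Kronecker-type argument unless a is in Z b + Z. *)
Require Import Defs.
From mathcomp Require Import all_boot all_order all_algebra finmap perm.
From mathcomp Require Import boolp classical_sets functions cardinality reals.
From mathcomp Require Import trigo.
From mathcomp Require Import zify ring lra.

Set Implicit Arguments.
Unset Strict Implicit.
Unset Printing Implicit Defensive.

Import Order.TTheory GRing.Theory Num.Theory.

Local Open Scope ring_scope.

(** * Distance to the nearest integer and Dirichlet approximation *)

Definition near_int (R : realType) (d t : R) : Prop :=
  exists z : int, `|t - z%:~R| < d.

(** Irrationality of [a], in the form used for multiples taken modulo 1. *)
Definition no_int_multiple (R : realType) (a : R) : Prop :=
  forall n : int, n != 0 -> n%:~R * a \isn't a Num.int.

Section NearInt.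
Variable R : realType.
Implicit Types (d e s t a : R).

Lemma near_intDz d t (z : int) : near_int d (t + z%:~R) <-> near_int d t.
Proof.
split=> -[w hw].
  by exists (w - z); rewrite intrB; move: hw; congr (`|_| < _); lra.
by exists (w + z); rewrite intrD; move: hw; congr (`|_| < _); lra.
Qed.

Lemma near_intN d t : near_int d t -> near_int d (- t).
Proof. by case=> z hz; exists (- z); rewrite intrN -opprD normrN. Qed.

Lemma near_intD d e s t :
  near_int d s -> near_int e t -> near_int (d + e) (s + t).
Proof.
move=> [z hz] [w hw]; exists (z + w); rewrite intrD opprD addrACA.
by apply: le_lt_trans (ler_normD _ _) _; apply: ltrD.
Qed.

Lemma near_int_small d t : `|t| < d -> near_int d t.
Proof. by move=> ht; exists 0; rewrite subr0. Qed.

Lemma near_intP d t :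
  near_int d t -> exists z : int, exists2 e : R, t = z%:~R + e & `|e| < d.
Proof. by case=> z hz; exists z, (t - z%:~R) => //; rewrite addrC subrK. Qed.

Lemma near_int_le d e t : d <= e -> near_int d t -> near_int e t.
Proof. by move=> de [z hz]; exists z; apply: lt_le_trans hz de. Qed.

Lemma not_int_away t : t \isn't a Num.int -> exists2 d, 0 < d & ~ near_int d t.
Proof.
move=> ht; have /andP[h1 h2] := floor_itv t.
have h1' : (Num.floor t)%:~R < t.
  by rewrite lt_neqAle h1 andbT; apply: contra ht => /eqP <-; apply: intr_int.
rewrite intrD in h2.
exists (Num.min (t - (Num.floor t)%:~R) ((Num.floor t)%:~R + 1 - t)).
  by rewrite lt_min; apply/andP; split; lra.
case=> z; rewrite lt_min => /andP[]; rewrite !ltr_norml => /andP[a1 a2] /andP[b1 b2].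
have hz1 : (Num.floor t)%:~R < (z%:~R : R) by lra.
have hz2 : z%:~R < ((Num.floor t + 1)%:~R : R) by rewrite intrD; lra.
by move: hz1 hz2; rewrite !ltr_int; lia.
Qed.

Lemma all_multiples_away a (g : nat) : no_int_multiple a ->
  exists2 d, 0 < d & forall k, (0 < k < g)%N -> ~ near_int d (k%:R * a).
Proof.
move=> ha; elim: g => [|g [d d0 hd]]; first by exists 1 => // k; rewrite andbF.
have [->|g0] := posnP g; first by exists 1 => // k; lia.
have /not_int_away [e e0 he] : g%:R * a \isn't a Num.int.
  by rewrite -[g%:R]/(g%:Z%:~R); apply: ha; lia.
exists (Num.min d e); first by rewrite lt_min d0.
move=> k hk; have [->|kg] := eqVneq k g.
  by move=> /near_int_le h; apply/he/h; rewrite ge_min lexx orbT.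
by move=> /near_int_le h; apply/(hd k); [lia | apply: h; rewrite ge_min lexx].
Qed.

(** Dirichlet's pigeonhole argument: among [M + 1] multiples of [a], two have fractional parts in
    the same box of width [1 / M < d]; subtract them. *)
Lemma exists_near_int_multiple a d : 0 < d ->
  exists2 y : nat, (0 < y)%N & near_int d (y%:R * a).
Proof.
move=> d0; set M := Num.bound d^-1.
have hM : d^-1 < M%:R by apply: archi_boundP; rewrite ltW// invr_gt0.
have M0 : (0 : R) < M%:R by apply: lt_trans hM; rewrite invr_gt0.
have M0' : (0 < M)%N by move: M0; rewrite ltr0n.
pose fr (i : nat) : R := i%:R * a - (Num.floor (i%:R * a))%:~R.
have fr0 i : 0 <= fr i by rewrite /fr subr_ge0 floor_le.
have fr1 i : fr i < 1.
  by rewrite /fr ltrBlDr addrC; have := floorD1_gt (i%:R * a); rewrite intrD.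
pose f (i : 'I_M.+1) : nat := Num.truncn (fr i * M%:R).
have hf (i : 'I_M.+1) : (f i)%:R <= fr i * M%:R < (f i).+1%:R.
  by apply: truncn_itv; rewrite mulr_ge0// ltW.
have fM (i : 'I_M.+1) : (f i < M)%N.
  have /andP[h _] := hf i; rewrite -(ltr_nat R); apply: le_lt_trans h _.
  by rewrite -[ltRHS]mul1r ltr_pM2r.
pose F (i : 'I_M.+1) : 'I_M := Ordinal (fM i).
have /injectivePn [i [j ij Fij]] : ~~ injectiveb F.
  apply/negP => /injectiveP /leq_card; rewrite !card_ord; lia.
have {Fij} fij : f i = f j by case: Fij.
wlog lij : i j ij fij / (i < j)%N.
  move=> H; have [|h|/val_inj h] := ltngtP i j; first exact: H.
    by apply: (H j i) => //; rewrite eq_sym.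
  by rewrite h eqxx in ij.
exists (j - i)%N; first by lia.
exists (Num.floor (j%:R * a) - Num.floor (i%:R * a)).
rewrite natrB ?(ltnW lij)// intrB.
have -> : (j%:R - i%:R) * a - ((Num.floor (j%:R * a))%:~R - (Num.floor (i%:R * a))%:~R)
  = fr j - fr i by rewrite /fr; ring.
rewrite -(ltr_pM2r M0) -[X in _ * X < _]ger0_norm ?ler0n// -normrM mulrBl.
have : 1 < d * M%:R by rewrite -(ltr_pM2l d0) mulfV ?gt_eqF// in hM.
have := hf i; have := hf j; rewrite fij -natr1 ltr_norml => /andP[? ?] /andP[? ?] ?.
by apply/andP; split; lra.
Qed.

(** Let [e] be the offset of [b] from its nearby integer. The multiples of [e] advance by less than
    1/4, too little to jump from around 0 to around another integer, so they stay bounded and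
    [e = 0]. *)
Lemma all_multiples_near_int (b : R) :
  (forall x : nat, near_int (1 / 4) (x%:R * b)) -> b \is a Num.int.
Proof.
move=> H; have [z [e be e4]] := near_intP (H 1%N); rewrite mul1r in be.
have small (x : nat) : `|x%:R * e| < 1 / 4.
  elim: x => [|x IH]; first by rewrite mul0r normr0; lra.
  have : near_int (1 / 4) (x.+1%:R * e).
    have := H x.+1; rewrite be mulrDr addrC => h.
    by apply/(near_intDz _ _ (x.+1%:Z * z)); rewrite intrM.
  case=> w; rewrite !ltr_norml in e4 IH *.
  rewrite (_ : x.+1%:R * e = x%:R * e + e); last by rewrite -natr1; ring.
  move: e4 IH => /andP[? ?] /andP[? ?] /andP[? ?].
  have w1 : - 1 < (w%:~R : R) by lra.
  have w2 : (w%:~R : R) < 1 by lra.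
  have w0 : w = 0.
    by move: w1 w2; rewrite -[1]/(1%:~R) -intrN !ltr_int; lia.
  by move: w0 => ?; subst w; apply/andP; split; lra.
suff e0 : e = 0 by rewrite be e0 addr0 intr_int.
apply/eqP; apply: contraT => ne0.
have := small (Num.bound `|e|^-1); rewrite normrM ger0_norm ?ler0n//.
have h : `|e|^-1 < (Num.bound `|e|^-1)%:R.
  by apply: archi_boundP; rewrite invr_ge0.
have : 1 < `|e| * (Num.bound `|e|^-1)%:R.
  by rewrite -(ltr_pM2l (x := `|e|)) ?normr_gt0// mulfV ?normr_eq0// in h.
by move=> ? ?; lra.
Qed.

End NearInt.

(** * Density of sets with large gaps *)

Lemma sparse_count (P : pred nat) (g : nat) : (0 < g)%N ->
  (forall x y, (x < y)%N -> P x -> P y -> (g <= y - x)%N) ->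
  forall n, ((\sum_(x < n) P x) * g < n + g)%N.
Proof.
move=> g0 hP; elim/ltn_ind => -[|n] IH; first by rewrite big_ord0 mul0n.
rewrite big_ord_recr /=; case: (boolP (P n)) => Pn; last first.
  by rewrite addn0 addSn; apply/ltnW/IH.
have gap : forall x, (x < n)%N -> (n < x + g)%N -> P x = false.
  by move=> x xn xg; apply/negP => Px; have := hP x n xn Px Pn; lia.
suff : ((\sum_(x < n) P x) * g <= n)%N by rewrite mulnDl mul1n addSn ltnS leq_add2r.
rewrite -(big_mkord xpredT (fun x => P x : nat)).
have [gn|gn] := leqP n.+1 g.
  by rewrite big_nat big1// => x /= xn; rewrite gap//; lia.
(* Of the [g] positions ending at [n] only [n] itself lies in [P]; the rest is the induction
   hypothesis at [n.+1 - g]. *)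
rewrite (@big_cat_nat _ _ _ (n.+1 - g)%N)/=; [|lia|lia].
rewrite [X in (_ + X)%N]big_nat_cond [X in (_ + X)%N]big1 ?addn0; last first.
  by move=> x /= hx; rewrite gap//; lia.
rewrite big_mkord; have := IH (n.+1 - g)%N ltac:(lia).
by rewrite subnK// ltnW.
Qed.

(** * A Kronecker-type theorem on simultaneous approximation *)

Section Kronecker.
Variable R : realType.
Implicit Types (d a th : R).

(* [n] is the degree of the circle map [x a |-> x th] (mod 1): one turn is
   covered by about [1 / s] steps of length [s = y0 a], each of which moves
   the image by [e = y0 th]. *)
Lemma kronecker_integer_multiple a th d : no_int_multiple a -> 0 < d ->
  (forall y : nat, near_int d (y%:R * a) -> near_int (1 / 24) (y%:R * th)) ->
  exists n : int, th - n%:~R * a \is a Num.int.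
Proof.
move=> ha d0 Hnat.
have H (y : int) : near_int d (y%:~R * a) -> near_int (1 / 24) (y%:~R * th).
  case: y => y; first exact: Hnat.
  rewrite NegzE intrN !mulNr => /near_intN; rewrite opprK => /Hnat.
  exact: near_intN.
have [y0 [z0 [s [yas s0 sd s1]]]] : exists y0 z0 : int, exists s : R,
    [/\ y0%:~R * a = z0%:~R + s, 0 < s, s < d & s < 1].
  have m0 : 0 < Num.min d 1 by rewrite lt_min d0 ltr01.
  have [y y_gt0 /near_intP [z [s ya]]] := exists_near_int_multiple a m0.
  rewrite lt_min => /andP[sd s1].
  have sn0 : s != 0.
    apply/eqP => s0; have /negP := ha y%:Z ltac:(lia); apply.
    by rewrite -[_%:~R]/(y%:R) ya s0 addr0 intr_int.
  rewrite !ltr_norml in sd s1; move/andP: sd => [? ?]; move/andP: s1 => [? ?].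
  have [sp|sp|/eqP] := ltrgtP s 0; last by rewrite (negbTE sn0).
    exists (- y%:Z), (- z), (- s); split; [|lra|lra|lra].
    by rewrite !intrN mulNr -[y%:~R]/(y%:R) ya; lra.
  by exists y%:Z, z, s; split; rewrite // -[_%:~R]/(y%:R).
have [w0 [e hye he]] : exists w : int, exists2 e : R,
    y0%:~R * th = w%:~R + e & `|e| < 1 / 24.
  apply/near_intP/H; rewrite yas addrC; apply/near_intDz/near_int_small.
  by rewrite gtr0_norm.
pose N := Num.truncn s^-1.
have /andP[N1 N2] : N%:R <= s^-1 < N.+1%:R.
  by apply: truncn_itv; rewrite invr_ge0 ltW.
have Ns1 : N%:R * s <= 1 by rewrite -ler_pdivlMr// div1r.
have Ns2 : 1 < N%:R * s + s.
  by move: N2; rewrite -div1r ltr_pdivrMr// -natr1 mulrDl mul1r.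
(* After [N] steps of length [s] the circle is traversed once up to less than [d], so the image is
   again near an integer: this is the degree [n]. *)
have [n hn] : near_int (1 / 24) (N%:R * e).
  have : near_int (1 / 24) ((N%:Z * y0)%:~R * th).
    apply: H; rewrite intrM -mulrA yas mulrDr.
    rewrite -[N%:~R]/(N%:R) (_ : _ + _ = (N%:R * s - 1) + (N%:Z * z0 + 1)%:~R).
      by apply/near_intDz/near_int_small; rewrite ltr_norml; apply/andP; split; lra.
    by rewrite intrD intrM -[N%:~R]/(N%:R); ring.
  rewrite intrM -mulrA hye mulrDr -[N%:~R * w0%:~R]intrM addrC => h.
  by move/near_intDz: h.
exists n; apply: all_multiples_near_int => x.
pose t := x%:R * a - (Num.floor (x%:R * a))%:~R.
have t0 : 0 <= t by rewrite /t subr_ge0 floor_le.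
have t1 : t < 1.
  by rewrite /t ltrBlDr addrC; have := floorD1_gt (x%:R * a); rewrite intrD.
(* [j] steps lead from 0 to within [s] of the fractional part [t] of [x a], so the hypothesis
   applies to [x - j y0]. *)
pose j := Num.truncn (t / s).
have /andP[j1 j2] : j%:R <= t / s < j.+1%:R.
  by apply: truncn_itv; rewrite divr_ge0// ltW.
have js1 : j%:R * s <= t by rewrite -ler_pdivlMr.
have js2 : t < j%:R * s + s.
  by rewrite -(mul1r s) mulrA mulr1 -mulrDl natr1 -ltr_pdivrMr.
have jN : (j <= N)%N.
  by rewrite -ltnS -(ltr_nat R); apply: le_lt_trans N2; apply: le_trans j1 _;
     rewrite -[leRHS]mul1r ler_pM2r ?invr_gt0// ltW.
have [w hw] : near_int (1 / 24) (x%:R * th - j%:R * e).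
  have : near_int (1 / 24) ((x%:Z - j%:Z * y0)%:~R * th).
    apply: H; rewrite intrB intrM mulrBl -mulrA yas -[j%:~R]/(j%:R) -[x%:~R]/(x%:R).
    rewrite (_ : _ - _ = (t - j%:R * s) + (Num.floor (x%:R * a) - j%:Z * z0)%:~R).
      by apply/near_intDz/near_int_small; rewrite ltr_norml; apply/andP; split; lra.
    by rewrite intrB intrM /t -[j%:~R]/(j%:R); ring.
  rewrite intrB intrM mulrBl -mulrA hye -[j%:~R]/(j%:R) -[x%:~R]/(x%:R).
  rewrite (_ : _ - _ = (x%:R * th - j%:R * e) + (- (j%:Z * w0))%:~R) => [h|].
    by move/near_intDz: h.
  by rewrite intrN intrM -[j%:~R]/(j%:R); ring.
have nN : `|n%:~R| * s <= 2 / 24.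
  have h1 : `|n%:~R| <= N%:R * `|e| + 1 / 24.
    rewrite -[n%:~R](subKr (N%:R * e)).
    apply: le_trans (ler_normB _ _) _; rewrite normrM ger0_norm ?ler0n//.
    by rewrite lerD2l ltW.
  apply: le_trans (_ : (N%:R * `|e| + 1 / 24) * s <= _); first by rewrite ler_pM2r.
  have h2 : N%:R * s * `|e| <= 1 / 24.
    by apply: le_trans (_ : 1 * `|e| <= _); [rewrite ler_wpM2r | rewrite mul1r ltW].
  by rewrite mulrDl mulrAC; lra.
have en : N%:R * `|e - n%:~R * s| < 3 / 24.
  rewrite -[X in X * _]ger0_norm ?ler0n// -normrM.
  rewrite (_ : _ * _ = (N%:R * e - n%:~R) + n%:~R * (1 - N%:R * s)); last by ring.
  apply: le_lt_trans (ler_normD _ _) _; rewrite normrM.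
  have : `|n%:~R| * `|1 - N%:R * s| <= `|n%:~R| * s :> R.
    by rewrite ler_wpM2l// ler_norml; apply/andP; split; lra.
  by lra.
have jn : j%:R * `|e - n%:~R * s| < 3 / 24.
  by apply: le_lt_trans en; rewrite ler_wpM2r// ler_nat.
have tn : `|n%:~R| * `|j%:R * s - t| <= 2 / 24.
  apply: le_trans nN; rewrite ler_wpM2l// ler_norml; apply/andP; split; lra.
(* The three errors, from [hw], [jn] and [tn], sum to less than 1/24 + 3/24 + 2/24 = 1/4; this is
   what the constant 1/24 is chosen for. *)
exists (w - n * Num.floor (x%:R * a)).
rewrite intrB intrM (_ : _ - _ = (x%:R * th - j%:R * e - w%:~R)
   + (j%:R * (e - n%:~R * s) + n%:~R * (j%:R * s - t))); last by rewrite /t; ring.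
apply: le_lt_trans (ler_normD _ _) _.
have := ler_normD (j%:R * (e - n%:~R * s)) (n%:~R * (j%:R * s - t)).
by rewrite !normrM (ger0_norm (ler0n _ j)); lra.
Qed.

End Kronecker.

(** * The sawtooth function and its correlations with sines *)

Section Sawtooth.
Variable R : realType.
Implicit Types (a b d e t th : R) (f h : nat -> R).

Definition saw t : R := t - (Num.floor t)%:~R - 1 / 2.

Lemma saw_bounds t : - (1 / 2) <= saw t < 1 / 2.
Proof.
rewrite /saw; have := floor_le t; have := floorD1_gt t; rewrite intrD => ? ?.
by apply/andP; split; lra.
Qed.

Lemma saw_norm t : `|saw t| <= 1.
Proof. by have /andP[? ?] := saw_bounds t; rewrite ler_norml; apply/andP; split; lra. Qed.

Lemma sawDz t u : u \is a Num.int -> saw (t + u) = saw t.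
Proof. by move=> ui; rewrite /saw floorDrz// intrD (floorK ui); ring. Qed.

Lemma sawN t : t \isn't a Num.int -> saw (- t) = - saw t.
Proof.
move=> ti; have /andP[h1 h2] := floor_itv t; rewrite intrD in h2.
have h1' : (Num.floor t)%:~R < t.
  by rewrite lt_neqAle h1 andbT; apply: contra ti => /eqP <-; apply: intr_int.
rewrite /saw (@floor_def _ (- t) (- Num.floor t - 1)).
  by rewrite intrB intrN; lra.
by rewrite intrD intrB intrN; apply/andP; split; lra.
Qed.

(** Modulo 1 the shift is by less than [d]. Off the [d]-neighbourhood of the integers it crosses no
    jump; inside it, the indicator pays for the jump. *)
Lemma saw_shift d t u : near_int d u ->
  `|saw (t + u) - saw t| <= d + `[< near_int d t >]%:R.
Proof.
move=> /near_intP [z [e -> ed]].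
rewrite (addrC z%:~R) addrA sawDz ?intr_int//.
have d0 : 0 < d by apply: le_lt_trans ed.
case: asboolP => /= ht.
  have /andP[? ?] := saw_bounds t; have /andP[? ?] := saw_bounds (t + e).
  by rewrite ler_norml; apply/andP; split; lra.
rewrite addr0 /saw (@floor_def _ (t + e) (Num.floor t)).
  by rewrite (_ : _ - _ = e) ?ltW//; ring.
have := floor_le t; have := floorD1_gt t; rewrite ltr_norml in ed.
move: ed => /andP[? ?]; rewrite !intrD => ? ?.
have h1 : d <= t - (Num.floor t)%:~R.
  rewrite leNgt; apply/negP => ?; apply: ht; exists (Num.floor t).
  by rewrite ltr_norml; apply/andP; split; lra.
have h2 : d <= (Num.floor t)%:~R + 1 - t.
  rewrite leNgt; apply/negP => ?; apply: ht; exists (Num.floor t + 1).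
  by rewrite ltr_norml intrD; apply/andP; split; lra.
by apply/andP; split; lra.
Qed.

Lemma sin_periodz t (z : int) : sin ((t + z%:~R) * (pi *+ 2)) = sin (t * (pi *+ 2)).
Proof.
case: z => n; rewrite ?NegzE ?intrN mulrDl ?mulNr mulr_natl.
  exact: (periodicn (@sinD2pi R)).
by rewrite -(periodicn (@sinD2pi R) n.+1) subrK.
Qed.

Lemma cos_periodz t (z : int) : cos ((t + z%:~R) * (pi *+ 2)) = cos (t * (pi *+ 2)).
Proof.
case: z => n; rewrite ?NegzE ?intrN mulrDl ?mulNr mulr_natl.
  exact: (periodicn (@cosD2pi R)).
by rewrite -(periodicn (@cosD2pi R) n.+1) subrK.
Qed.

(** Reduce [t] modulo 1 to [[-1/2, 1/2]] and use that cosine is even and decreasing on [[0, pi]]. *)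
Lemma cos_away d t : 0 < d -> ~ near_int d t ->
  cos (t * (pi *+ 2)) <= cos (d * (pi *+ 2)) < 1.
Proof.
move=> d0 ht; pose z := Num.floor (t + 1 / 2); pose r := t - z%:~R.
have := floor_le (t + 1 / 2); have := floorD1_gt (t + 1 / 2).
rewrite intrD -/z => hz1 hz2.
have r2 : `|r| <= 1 / 2 by rewrite /r ler_norml; apply/andP; split; lra.
have rd : d <= `|r| by rewrite leNgt; apply/negP => h; apply: ht; exists z.
have p0 : 0 < pi *+ 2 :> R by rewrite pmulrn_rgt0// pi_gt0.
have itv (u : R) : 0 <= u -> u <= 1 / 2 -> u * (pi *+ 2) \in `[0, pi].
  move=> u0 u1; rewrite in_itv /= mulr_ge0 ?(ltW p0)//=.
  apply: le_trans (_ : 1 / 2 * (pi *+ 2) <= _); first by rewrite ler_pM2r.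
  by rewrite -mulr_natr; lra.
apply/andP; split; last first.
  rewrite -[ltRHS]cos0 -(mul0r (pi *+ 2)) ltr_cos ?itv//; [|lra|lra|lra].
  by rewrite ltr_pM2r.
rewrite -(subrK z%:~R t) -/r cos_periodz -cos_norm normrM (gtr0_norm p0).
move: rd; rewrite le_eqVlt => /predU1P [->//|rd].
apply/ltW; rewrite ltr_cos ?itv//; [|lra|lra].
by rewrite ltr_pM2r.
Qed.

(** Convergence of the Cesàro means to 0, written without division. *)
Definition mean_zero f : Prop := forall e, 0 < e ->
  exists N : nat, forall n, (N <= n)%N -> `|\sum_(x < n) f x| <= e * n%:R.

Lemma bounded_mean_zero f K : (forall n, `|\sum_(x < n) f x| <= K) -> mean_zero f.
Proof.
move=> fK e e0; exists (Num.bound (K / e)) => n hn.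
apply: le_trans (fK n) _; rewrite mulrC -ler_pdivrMr//.
have K0 : 0 <= K by apply: le_trans (fK 0%N).
have : K / e < (Num.bound (K / e))%:R by apply: archi_boundP; rewrite divr_ge0// ltW.
by move/ltW/le_trans; apply; rewrite ler_nat.
Qed.

Lemma eventually0_mean_zero f N : (forall x, (N <= x)%N -> f x = 0) -> mean_zero f.
Proof.
move=> f0; apply: (@bounded_mean_zero _ (\sum_(x < N) `|f x|)) => n.
apply: le_trans (ler_norm_sum _ _ _) _.
rewrite -(big_mkord xpredT (fun x => `|f x|)) -(big_mkord xpredT (fun x => `|f x|)).
have [nN|nN] := leqP n N.
  by rewrite [leRHS](@big_cat_nat _ _ _ n)//= lerDl sumr_ge0.
rewrite (@big_cat_nat _ _ _ N)//= ?(ltnW nN)// [X in _ + X]big_nat.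
by rewrite [X in _ + X]big1 ?addr0// => x /andP[xN _]; rewrite f0// normr0.
Qed.

Lemma mean_zeroD f h : mean_zero f -> mean_zero h -> mean_zero (fun x => f x + h x).
Proof.
move=> Hf Hh e e0; have e2 : 0 < e / 2 by lra.
have [N hN] := Hf _ e2; have [M hM] := Hh _ e2.
exists (maxn N M) => n; rewrite geq_max => /andP[/hN n1 /hM n2].
by rewrite big_split/=; apply: le_trans (ler_normD _ _) _; lra.
Qed.

Lemma mean_zeroZ (c : R) f : mean_zero f -> mean_zero (fun x => c * f x).
Proof.
move=> Hf e e0; have c0 : 0 < `|c| + 1 by rewrite ltr_wpDl.
have [N hN] := Hf _ (divr_gt0 e0 c0); exists N => n /hN hn.
rewrite -mulr_sumr normrM; apply: le_trans (_ : (`|c| + 1) * `|\sum_(x < n) f x| <= _).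
  by rewrite ler_wpM2r// lerDl.
by move: hn; rewrite mulrAC ler_pdivlMr// mulrC.
Qed.

Lemma mean_zero_sum (T : Type) (s : seq T) (P : pred T) (F : T -> nat -> R) :
  (forall i, P i -> mean_zero (F i)) -> mean_zero (fun x => \sum_(i <- s | P i) F i x).
Proof.
move=> HF; elim: s => [|i s IH].
  by apply: (@eventually0_mean_zero _ 0%N) => x _; rewrite big_nil.
under [X in mean_zero X]eq_fun do rewrite big_cons.
by case Pi: (P i) => //; apply: mean_zeroD IH; apply: HF.
Qed.

(** Each unit shift telescopes to two boundary terms of size at most 1. *)
Lemma sum_shift f y n : (forall x, `|f x| <= 1) ->
  `|\sum_(x < n) f (x + y)%N - \sum_(x < n) f x| <= 2 * y%:R.
Proof.
move=> f1; elim: y => [|y IH].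
  under eq_bigr do rewrite addn0.
  by rewrite subrr normr0 mulr0.
have step : `|\sum_(x < n) f (x + y.+1)%N - \sum_(x < n) f (x + y)%N| <= 2.
  rewrite -sumrB.
  rewrite -(big_mkord xpredT (fun x => f (x + y.+1)%N - f (x + y)%N)).
  under eq_bigr do rewrite addnS -addSn.
  rewrite (telescope_sumr (fun x => f (x + y)%N) (leq0n n)).
  have := f1 (n + y)%N; have := f1 (0 + y)%N.
  by have := ler_normB (f (n + y)%N) (f (0 + y)%N); lra.
rewrite -natr1 -(subrKA (\sum_(x < n) f (x + y)%N)).
by apply: le_trans (ler_normD _ _) _; lra.
Qed.

(* Shifting by [y] rotates the pair of cosine and sine sums by the angle [y
   * phi], up to an error [E]; a rotation that is not close to the identity
   moves a vector by a fixed proportion of its length. *)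
Lemma rotation_bound h (phi : R) y n : (forall x, `|h x| <= 1) ->
  2 * (1 - cos (y%:R * phi)) * `|\sum_(x < n) h x * sin (x%:R * phi)| <=
  3 * (\sum_(x < n) `|h (x + y)%N - h x| + 2 * y%:R).
Proof.
move=> h1; set E := _ + 2 * _; set c := cos _; set s := sin (y%:R * phi).
set V := \sum_(x < n) _; pose U := \sum_(x < n) h x * cos (x%:R * phi).
pose D := \sum_(x < n) `|h (x + y)%N - h x|.
have s1 : `|s| <= 1 by apply: sin_max.
have c1 : `|1 - c| <= 2.
  have := cos_geN1 (y%:R * phi); have := cos_le1 (y%:R * phi).
  by rewrite -/c ler_norml => ? ?; apply/andP; split; lra.
have err (w : R -> R) : (forall t, `|w t| <= 1) ->
    `|\sum_(x < n) h x * w ((x + y)%N%:R * phi) - \sum_(x < n) h x * w (x%:R * phi)| <= E.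
  move=> w1; pose f x := h x * w (x%:R * phi).
  have f1 x : `|f x| <= 1.
    by rewrite normrM; apply: le_trans (_ : 1 * 1 <= _); [apply: ler_pM | rewrite mulr1].
  have hs := sum_shift y n f1.
  rewrite -(subrKA (\sum_(x < n) f (x + y)%N)).
  apply: le_trans (ler_normD _ _) _; apply: lerD => //.
  rewrite -sumrB; apply: le_trans (ler_norm_sum _ _ _) _.
  apply: ler_sum => x _; rewrite /f -mulrBl normrM distrC.
  by rewrite -[leRHS]mulr1 ler_wpM2l.
have EV : `|c * V + s * U - V| <= E.
  have := err (@sin R) (@sin_max R); congr (`|_ - _| <= _).
  rewrite mulr_sumr mulr_sumr -big_split/=; apply: eq_bigr => x _.
  by rewrite natrD mulrDl sinD -/c -/s; ring.
have EU : `|c * U - s * V - U| <= E.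
  have := err (@cos R) (@cos_max R); congr (`|_ - _| <= _).
  rewrite mulr_sumr mulr_sumr -sumrB; apply: eq_bigr => x _.
  by rewrite natrD mulrDl cosD -/c -/s; ring.
have cs : s ^+ 2 = 1 - c ^+ 2 by apply: sin2cos2.
have cge : 0 <= 2 * (1 - c).
  by have := cos_le1 (y%:R * phi); rewrite -/c => ?; lra.
rewrite -(ger0_norm cge) -normrM.
(* The weights [1 - c] and [s] cancel [U]; the coefficient left on [V] is
   [(1 - c)^2 + s^2 = 2 (1 - c)] up to sign. The weights are at most 2 and 1 in size, whence the
   factor 3. *)
rewrite (_ : _ * V = - ((1 - c) * (c * V + s * U - V) + s * (c * U - s * V - U))); last first.
  rewrite (_ : - _ = ((1 - c) ^+ 2 + s ^+ 2) * V); last by ring.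
  by rewrite cs; ring.
rewrite normrN; apply: le_trans (ler_normD _ _) _; rewrite !normrM.
have : `|1 - c| * `|c * V + s * U - V| <= 2 * E by apply: ler_pM.
have : `|s| * `|c * U - s * V - U| <= 1 * E by apply: ler_pM.
by lra.
Qed.

(** Two visits to the [d]-neighbourhood of the integers differ by some [k] with [k a] within [2 d]
    of an integer, so they are at least [g] apart. *)
Lemma near_int_count a d (g n : nat) : (0 < g)%N ->
  (forall k, (0 < k < g)%N -> ~ near_int (d *+ 2) (k%:R * a)) ->
  (\sum_(x < n) `[< near_int d (x%:R * a) >]%:R) * g%:R <= n%:R + g%:R :> R.
Proof.
move=> g0 hd; rewrite -natr_sum -natrM -natrD ler_nat; apply/ltnW.
apply: (@sparse_count (fun x => `[< near_int d (x%:R * a) >])) => // x y xy.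
move=> /asboolP hx /asboolP hy; rewrite leqNgt; apply/negP => yx.
apply: (hd (y - x)%N); first by rewrite subn_gt0 xy yx.
rewrite (natrB R (ltnW xy)) mulrBl mulr2n.
exact: near_intD hy (near_intN hx).
Qed.

(** Some [y] has [y b] nearly an integer and [y th] not: shifting by [y] barely changes the sawtooth
    but truly rotates the sine, so [rotation_bound] forces a small sum. *)
Lemma mean_zero_saw_sin b th : no_int_multiple b ->
  (forall n : int, th - n%:~R * b \isn't a Num.int) ->
  mean_zero (fun x => saw (x%:R * b) * sin (x%:R * (th * (pi *+ 2)))).
Proof.
move=> hb hth e e0.
have d24 : (0 : R) < 1 / 24 by lra.
pose k : R := 1 - cos (1 / 24 * (pi *+ 2)).
have k0 : 0 < k.
  have nn : ~ near_int (1 / 24) (1 / 2 : R).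
    case=> z; rewrite ltr_norml => /andP[? ?].
    have z0 : (0 : R) < z%:~R by lra.
    have z1 : (z%:~R : R) < 1 by lra.
    by move: z0 z1; rewrite -[1]/(1%:~R) ltr_int ltr0z; lia.
  by have /andP[_] := cos_away d24 nn; rewrite /k subr_gt0.
(* The shift error is at most [2 q n + 1]: one [q n] from the displacement [d <= q], one from the
   jumps, which have density at most [1 / g < q]. Tripled this is [e k n + 3], and [N] absorbs the
   constants. *)
pose q := e * k / 6.
have q0 : 0 < q by rewrite divr_gt0// mulr_gt0.
pose g := Num.bound q^-1.
have hg : q^-1 < g%:R by apply: archi_boundP; rewrite invr_ge0 ltW.
have g0' : (0 : R) < g%:R by apply: lt_trans hg; rewrite invr_gt0.
have g0 : (0 < g)%N by rewrite -(ltr_nat R).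
have [d1 d10 hd1] := all_multiples_away g hb.
pose d := Num.min q (d1 / 2).
have d0 : 0 < d by rewrite lt_min q0/=; lra.
have dq : d <= q by rewrite ge_min lexx.
have dd1 : d *+ 2 <= d1.
  have : d <= d1 / 2 by rewrite ge_min lexx orbT.
  by rewrite -mulr_natr; lra.
have [y hy hyth] : exists2 y : nat, near_int d (y%:R * b) & ~ near_int (1 / 24) (y%:R * th).
  apply: contrapT => H; have [|n hn] := kronecker_integer_multiple hb d0 (th := th).
    by move=> y hy; apply: contrapT => hyth; apply: H; exists y.
  by have := hth n; rewrite hn.
have [N hN] : exists N : nat, 3 * (1 + 2 * y%:R) <= e * k * N%:R.
  exists (Num.bound (3 * (1 + 2 * y%:R) / (e * k))).
  rewrite [leRHS]mulrC -ler_pdivrMr ?mulr_gt0//; apply/ltW/archi_boundP.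
  by have y0 := ler0n R y; apply: divr_ge0; [lra | rewrite ltW// mulr_gt0].
exists N => n Nn.
have := rotation_bound (th * (pi *+ 2)) y n (fun x => saw_norm (x%:R * b)).
rewrite mulrA; have /andP[ck _] := cos_away d24 hyth.
set V := `|\sum_(x < n) _|; set S := \sum_(x < n) _ => hV.
have V0 : 0 <= V by apply: normr_ge0.
have hkV : 2 * k * V <= 3 * (S + 2 * y%:R).
  by apply: le_trans hV; rewrite ler_wpM2r// ler_pM2l// /k; lra.
have hS : S <= d * n%:R + (\sum_(x < n) `[< near_int d (x%:R * b) >]%:R).
  rewrite mulr_natr -[X in d *+ X]card_ord -sumr_const -big_split/=.
  apply: ler_sum => x _; rewrite natrD mulrDl; exact: saw_shift.
have hc : \sum_(x < n) `[< near_int d (x%:R * b) >]%:R <= q * n%:R + 1.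
  have := @near_int_count b d g n g0 (fun j hj hjd => hd1 j hj (near_int_le dd1 hjd)).
  rewrite -ler_pdivlMr// mulrDl divff ?gt_eqF// => h; apply: le_trans h _.
  rewrite lerD2r mulrC ler_wpM2r// -[leRHS]invrK lef_pV2 ?posrE ?invr_gt0//.
  exact: ltW.
have hNn : e * k * N%:R <= e * k * n%:R by rewrite ler_pM2l ?mulr_gt0// ler_nat.
have hdq : d * n%:R <= q * n%:R by rewrite ler_wpM2r.
have : k * V <= k * (e * n%:R).
  have -> : k * (e * n%:R) = 6 * (q * n%:R) by rewrite /q; field.
  have hh : e * k * n%:R = 6 * (q * n%:R) by rewrite /q; field.
  by lra.
by rewrite ler_pM2l.
Qed.

(** [rotation_bound] for a constant function and a unit shift leaves only the boundary error, so the
    partial sums are bounded. *)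
Lemma mean_zero_sin th : th \isn't a Num.int ->
  mean_zero (fun x => sin (x%:R * (th * (pi *+ 2)))).
Proof.
move=> /not_int_away [d d0 hd]; have /andP[h1 h2] := cos_away d0 hd.
pose k := 1 - cos (th * (pi *+ 2)).
have k0 : 0 < k by rewrite /k; lra.
apply: (@bounded_mean_zero _ (3 / k)) => n.
have := @rotation_bound (fun=> 1) (th * (pi *+ 2)) 1 n (fun=> ltac:(by rewrite normr1)).
rewrite mul1r -/k; under eq_bigr do rewrite mul1r.
rewrite [X in 3 * (X + _)]big1 => [h|x _]; last by rewrite subrr normr0.
by rewrite ler_pdivlMr// mulrC; lra.
Qed.

(** On each half of a period the two factors have opposite signs. *)
Lemma saw_sin_le0 t : saw t * sin (t * (pi *+ 2)) <= 0.
Proof.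
pose r := t - (Num.floor t)%:~R.
have r0 : 0 <= r by rewrite /r subr_ge0 floor_le.
have r1 : r < 1.
  by rewrite /r ltrBlDr addrC; have := floorD1_gt t; rewrite intrD.
have -> : saw t = r - 1 / 2 by [].
rewrite -(subrK (Num.floor t)%:~R t) -/r sin_periodz -[pi *+ 2]mulr_natr.
have p0 := pi_gt0 R.
have [rh|rh] := lerP r (1 / 2).
  apply: mulr_le0_ge0; first lra.
  apply: sin_ge0_pi; apply/andP; split.
    by apply: mulr_ge0 => //; apply: mulr_ge0 => //; exact: ltW.
  have : r * pi <= 1 / 2 * pi by rewrite ler_pM2r.
  by lra.
apply: mulr_ge0_le0; first lra.
rewrite (_ : r * _ = (r * 2 - 1) * pi + pi); last by ring.
rewrite sinDpi oppr_le0; apply: sin_ge0_pi; apply/andP; split.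
  by rewrite mulr_ge0 ?(ltW p0)//; lra.
by rewrite -[leRHS]mul1r ler_pM2r//; lra.
Qed.

(** [2 * saw t] is the difference of [2 t] and an odd integer, which bounds the first factor; for
    the second, [|sin u| >= sin^2 u = (1 - cos (2 u)) / 2]. *)
Lemma saw_sin_away d t : 0 < d -> ~ near_int d (2 * t) ->
  d / 2 * ((1 - cos (d * (pi *+ 2))) / 2) <= - (saw t * sin (t * (pi *+ 2))).
Proof.
move=> d0 hd; rewrite -(ler0_norm (saw_sin_le0 t)) normrM.
have /andP[h1 h2] := cos_away d0 hd.
apply: ler_pM; [lra|lra| |].
  rewrite leNgt; apply/negP => h; apply: hd; exists (2 * Num.floor t + 1).
  rewrite (_ : _ - _ = 2 * saw t); last by rewrite intrD intrM /saw; field.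
  by rewrite normrM ger0_norm//; lra.
rewrite -mulrA mulr_natl cos_mulr2n cos2sin2 in h1.
have : sin (t * (pi *+ 2)) ^+ 2 <= `|sin (t * (pi *+ 2))|.
  rewrite -real_normK ?num_real// expr2 -[leRHS]mulr1 ler_wpM2l//.
  exact: sin_max.
by rewrite -mulr_natr in h1 *; lra.
Qed.

Lemma not_mean_zero_saw_sin a : no_int_multiple a ->
  ~ mean_zero (fun x => saw (x%:R * a) * sin (x%:R * (a * (pi *+ 2)))).
Proof.
move=> ha H.
have /not_int_away [d1 d10 hd1] := ha 2 isT.
pose d := d1 / 2; have d0 : 0 < d by rewrite /d; lra.
have d2 : d *+ 2 = d1 by rewrite /d -mulr_natr; lra.
pose k := d / 2 * ((1 - cos (d * (pi *+ 2))) / 2).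
have k0 : 0 < k.
  have hd : ~ near_int d (2%:~R * a).
    by move/(near_int_le (e := d1)) => h; apply/hd1/h; rewrite /d; lra.
  have /andP[_ ?] := cos_away d0 hd.
  by apply: mulr_gt0; lra.
(* Consecutive [x] are never both exceptional, so at least [n / 2 - 1] terms contribute [k] or more
   in size; this exceeds [n / 4] once [n > 4], hence [N + 5] below. *)
have [|N hN] := H (k / 4); first by lra.
have := hN (N + 5)%N (leq_addr _ _).
set n := (N + 5)%N; rewrite ler_norml => /andP[hn _].
have low : k * n%:R - k * \sum_(x < n) `[< near_int d (x%:R * (2 * a)) >]%:R
    <= - \sum_(x < n) saw (x%:R * a) * sin (x%:R * (a * (pi *+ 2))).
  rewrite -mulrBr -[X in X%:R]card_ord -sumr_const -sumrB mulr_sumr -sumrN.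
  apply: ler_sum => x _; rewrite !mulrA; case: asboolP => h /=.
    by rewrite subrr mulr0 oppr_ge0 saw_sin_le0.
  by rewrite subr0 mulr1 saw_sin_away// mulrA (mulrC 2).
have cnt : (\sum_(x < n) `[< near_int d (x%:R * (2 * a)) >]%:R) * 2 <= n%:R + 2 :> R.
  apply: near_int_count => // j hj; rewrite d2.
  have -> : j = 1%N by lia.
  by rewrite mul1r; exact: hd1.
have kcnt : k * ((\sum_(x < n) `[< near_int d (x%:R * (2 * a)) >]%:R) * 2) <= k * (n%:R + 2).
  exact: ler_wpM2l (ltW k0) _ _ cnt.
have kn : k * 5 <= k * n%:R by rewrite ler_pM2l// /n natrD lerDr.
by lra.
Qed.

End Sawtooth.

(** * Extraction of complementary pairs *)

Lemma seq_minimal (T : eqType) (lt : T -> T -> Prop) (s : seq T) :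
  (forall y x z, lt x y -> lt y z -> lt x z) -> {in s, forall x, ~ lt x x} ->
  s != [::] -> exists2 m, m \in s & {in s, forall x, ~ lt x m}.
Proof.
move=> tr; elim: s => // x s IH irr _.
have [->|s0] := eqVneq s [::].
  by exists x; rewrite ?mem_head// => y; rewrite inE => /eqP ->; apply: irr; rewrite mem_head.
have [y ys ymin] := IH (fun z zs => irr z (mem_behead (s := x :: s) zs)) s0.
have [xy|xy] := pselect (lt x y).
  exists x; rewrite ?mem_head// => z; rewrite inE => /predU1P [->|zs].
    by apply: irr; rewrite mem_head.
  by move=> zx; apply: (ymin z zs); apply: tr zx xy.
exists y; first by rewrite inE ys orbT.
by move=> z; rewrite inE => /predU1P [->|/ymin].
Qed.

Section Pairing.
Variable R : realType.
Implicit Types (a b : R) (s : seq R).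

(** Requiring [|n| > 1] gives a strict order on irrational numbers, so a nonempty finite list has a
    minimal entry. *)
Definition proper_multiple b a : Prop :=
  exists2 n : int, (1 < `|n|)%N & a - n%:~R * b \is a Num.int.

Lemma proper_multiple_trans b a c :
  proper_multiple a b -> proper_multiple b c -> proper_multiple a c.
Proof.
move=> [n n1 hn] [p p1 hp]; exists (p * n); first by rewrite abszM; nia.
rewrite (_ : _ - _ = (c - p%:~R * b) + p%:~R * (b - n%:~R * a)); last first.
  by rewrite intrM; ring.
by rewrite rpredD// rpredM// intr_int.
Qed.

Lemma proper_multiple_irr a : no_int_multiple a -> ~ proper_multiple a a.
Proof.
move=> ha [n n1 hn]; have /negP := ha (1 - n) ltac:(lia); apply.
by rewrite intrB mulrBl mul1r.
Qed.

Lemma exists_complement s : s != [::] -> {in s, forall a, no_int_multiple a} ->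
  (exists (C : R) (N : nat), forall x, (N <= x)%N -> \sum_(a <- s) saw (x%:R * a) = C) ->
  exists a b, [/\ a \in s, b \in s & a + b \is a Num.int].
Proof.
move=> s0 hs [C [N hC]].
have [a as_ amin] := seq_minimal proper_multiple_trans
   (fun a h => proper_multiple_irr (hs a h)) s0.
apply: contrapT => nocompl.
pose w x := sin (x%:R * (a * (pi *+ 2))).
pose P b := b - a \is a Num.int.
have small : mean_zero (fun x => \sum_(b <- s | (b \in s) && ~~ P b) (saw (x%:R * b) * w x)).
  apply: (@mean_zero_sum _ _ s (fun b => (b \in s) && ~~ P b)
      (fun b x => saw (x%:R * b) * w x)) => b /andP[bs nPb].
  apply: mean_zero_saw_sin; first exact: hs.
  move=> n; apply/negP => hn.
  (* Minimality of [a] leaves three cases: [n = 0] makes [a] an integer, [n = 1] gives [P b], and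
     [n = -1] gives a complement of [a]. *)
  have [n1|n1] := ltnP 1 `|n|%N; first by apply: (amin b bs); exists n.
  have [n0|[n0|n0]] : n = 0 \/ n = 1 \/ n = -1 by lia.
  - have /negP := hs a as_ 1 isT; apply; rewrite mul1r.
    by rewrite n0 mul0r subr0 in hn.
  - move/negP: nPb; apply; rewrite /P -opprB rpredN.
    by rewrite n0 mul1r in hn.
  - apply: nocompl; exists a, b; split=> //.
    by rewrite n0 mulN1r opprK in hn.
have cst : mean_zero (fun x => C * w x).
  apply: mean_zeroZ; apply: mean_zero_sin; apply/negP => h.
  by have /negP := hs a as_ 1 isT; rewrite mul1r.
have tail : mean_zero (fun x => (\sum_(b <- s) saw (x%:R * b) - C) * w x).
  by apply: (@eventually0_mean_zero _ _ N) => x Nx; rewrite hC// subrr mul0r.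
pose c := (count P s)%:R : R.
have c0 : c != 0.
  rewrite pnatr_eq0 -lt0n -has_count; apply/hasP; exists a => //.
  by rewrite /P subrr.
apply: (not_mean_zero_saw_sin (hs a as_)).
(* The terms with [P b] sum to [c * saw (x a)]; they are the whole sum, [tail] plus [cst], minus
   [small]. *)
have := mean_zeroZ c^-1 (mean_zeroD tail (mean_zeroD cst (mean_zeroZ (-1) small))).
congr mean_zero; apply/funext => x.
rewrite -big_seq_cond -mulr_suml.
have -> : \sum_(b <- s) saw (x%:R * b) = c * saw (x%:R * a) + \sum_(b <- s | ~~ P b) saw (x%:R * b).
  rewrite (bigID P)/=; congr (_ + _).
  rewrite /c mulr_natl (eq_bigr (fun=> saw (x%:R * a))) => [|b Pb].
    by rewrite big_const_seq iter_addr_0.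
  rewrite -(subrK a b) mulrDr addrC sawDz//.
  by rewrite rpredM// natr_int.
by rewrite -/(w x); field.
Qed.

(** At [x = 0] both terms are [-1/2], hence the condition [0 < x]. *)
Lemma saw_complement a b (x : nat) : (0 < x)%N -> no_int_multiple a ->
  a + b \is a Num.int -> saw (x%:R * a) + saw (x%:R * b) = 0.
Proof.
move=> x0 ha hab.
rewrite (_ : x%:R * b = - (x%:R * a) + x%:R * (a + b)); last by ring.
rewrite sawDz ?rpredM ?natr_int// sawN ?subrr//.
by apply: (ha x%:Z); lia.
Qed.

Lemma complementary_pairs s : {in s, forall a, no_int_multiple a} ->
  (exists (C : R) (N : nat), forall x, (N <= x)%N -> \sum_(a <- s) saw (x%:R * a) = C) ->
  exists2 p : seq (R * R), perm_eq (flatten [seq [:: u.1; u.2] | u <- p]) s &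
    {in p, forall u, u.1 + u.2 \is a Num.int}.
Proof.
have [n] := ubnP (size s); elim: n s => // n IH s sn hs const.
have [->|s0] := eqVneq s [::]; first by exists [::].
have [a [b [as_ bs hab]]] := exists_complement s0 hs const.
(* Otherwise [2 a] would be an integer; so [b] survives the removal of [a]. *)
have ba : b != a.
  apply/eqP => ba; have /negP := hs a as_ 2 isT; apply.
  by rewrite mulr_natl mulr2n -{2}ba.
have bs' : b \in rem a s.
  by have := perm_mem (perm_to_rem as_) b; rewrite bs inE (negbTE ba).
set s' := rem b (rem a s).
have ps : perm_eq s [:: a, b & s'].
  by apply: perm_trans (perm_to_rem as_) _; rewrite perm_cons; apply: perm_to_rem.
have sub : {subset s' <= s} by move=> c cs; rewrite (perm_mem ps) !inE cs !orbT.
have [|c cs||p pp hp] := IH s'.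
- by have := perm_size ps => /=; lia.
- exact/hs/sub.
- have [C [N hC]] := const; exists C, N.+1 => x Nx.
  rewrite -(hC x (ltnW Nx)) (perm_big _ ps) /= !big_cons addrA saw_complement ?add0r//.
    by lia.
  exact: hs.
exists ((a, b) :: p) => [|u].
  by rewrite /= perm_sym; apply: perm_trans ps _; rewrite !perm_cons perm_sym.
by rewrite inE => /predU1P [->//|/hp].
Qed.

End Pairing.

(** * Multiplicities in Beatty sequences *)

Lemma no_int_multipleV (R : realType) (alpha : R) :
  irrational alpha -> no_int_multiple alpha^-1.
Proof.
move=> irr n n0; apply/negP => /intrP [z hz]; apply: (irr).
have a0 : alpha != 0.
  by apply/eqP => a0; apply: irr; exists 0; rewrite // a0 rmorph0.
have z0 : z%:~R != 0 :> R.
  by rewrite -hz mulf_neq0 ?invr_eq0// intr_eq0.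
exists (n%:~R / z%:~R) => //; rewrite fmorph_div !rmorph_int.
by rewrite -hz invfM invrK mulrA divff ?intr_eq0// mul1r.
Qed.

Section Counting.
Variable R : realType.
Implicit Types alpha : R.

(** The indices giving [x] lie between [x / alpha] and [(x + 1) / alpha]. By irrationality neither
    end is an integer, so they are the [n] with [p < n <= q]. *)
Lemma beatty_saw alpha (x : nat) : 0 < alpha -> irrational alpha -> (0 < x)%N ->
  (beatty alpha 0 x%:Z)%:R =
  alpha^-1 + saw (x%:R * alpha^-1) - saw (x.+1%:R * alpha^-1).
Proof.
move=> a0 irr x0; have irrV := no_int_multipleV irr.
have ai0 : 0 < alpha^-1 by rewrite invr_gt0.
have trunc_floor (y : nat) : (Num.floor (y%:R * alpha^-1))%:~R
    = (Num.truncn (y%:R * alpha^-1))%:R :> R.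
  have h : 0 <= y%:R * alpha^-1 by apply: mulr_ge0 => //; exact: ltW.
  have f0 : 0 <= Num.floor (y%:R * alpha^-1) by rewrite floor_ge0.
  by rewrite truncn_floor h -[in LHS](gez0_abs f0).
set p := Num.truncn (x%:R * alpha^-1); set q := Num.truncn (x.+1%:R * alpha^-1).
have /andP[p1 p2] : p%:R <= x%:R * alpha^-1 < p.+1%:R.
  by apply: truncn_itv; rewrite mulr_ge0// ltW.
have /andP[q1 q2] : q%:R <= x.+1%:R * alpha^-1 < q.+1%:R.
  by apply: truncn_itv; rewrite mulr_ge0// ltW.
have neq (y n : nat) : (0 < y)%N -> y%:R * alpha^-1 != n%:R.
  move=> y0; apply/eqP => h; have /negP := irrV y%:Z ltac:(lia); apply.
  by rewrite -[_%:~R]/(y%:R) h natr_int.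
have -> : beatty alpha 0 x%:Z = (q - p)%N.
  pose X := seq_fset tt (iota p.+1 (q - p)).
  have XE n : (n \in X) = (p < n < p.+1 + (q - p))%N by rewrite seq_fsetE mem_iota.
  rewrite /beatty (_ : beatty_index alpha 0 x = [set` X]%classic).
    by rewrite set_fsetK size_seq_fset undup_id ?iota_uniq// size_iota.
  apply/seteqP; split=> n /=; rewrite XE /beatty_index /= addr0.
    move=> [n0 /eqP]; rewrite floor_eq -[x%:Z%:~R]/(x%:R) intrD => /andP[].
    rewrite -ler_pdivrMr// -ltr_pdivlMr// natr1 => h1 h2.
    have : (p < n)%N.
      rewrite -(ltr_nat R); apply: le_lt_trans p1 _.
      by rewrite lt_neqAle h1 andbT neq.
    have : (n < q.+1)%N by rewrite -(ltr_nat R); apply: lt_trans q2.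
    by lia.
  move=> hn; have pn : (p < n)%N by lia.
  have nq : (n <= q)%N by lia.
  split; first lia.
  apply/eqP; rewrite floor_eq -[x%:Z%:~R]/(x%:R) intrD.
  rewrite -ler_pdivrMr// -ltr_pdivlMr// natr1; apply/andP; split.
    by apply/ltW/(lt_le_trans p2); rewrite ler_nat.
  rewrite lt_neqAle eq_sym neq//=.
  by apply: le_trans q1; rewrite ler_nat.
have pq : (p <= q)%N by apply: le_truncn; rewrite ler_pM2r// ler_nat.
rewrite natrB// /saw !trunc_floor -/p -/q -natr1; ring.
Qed.

(** By [beatty_saw] the multiplicity of [x] is [m + S x - S x.+1], which is [m] exactly when [S]
    does not change from [x] to [x + 1]. *)
Lemma is_EEC_saw (m k : nat) (alpha : 'I_k -> R) :
  (forall i, 0 < alpha i) -> (forall i, irrational (alpha i)) ->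
  \sum_(i < k) (alpha i)^-1 = m%:R ->
  is_EEC m (fun i => beatty (alpha i) 0) <->
  exists (C : R) (N : nat), forall x, (N <= x)%N ->
    \sum_(i < k) saw (x%:R * (alpha i)^-1) = C.
Proof.
move=> a0 irr am; pose S (x : nat) := \sum_(i < k) saw (x%:R * (alpha i)^-1).
have key (x : nat) : (0 < x)%N ->
    (munion (fun i => beatty (alpha i) 0) x%:Z)%:R = m%:R + S x - S x.+1 :> R.
  move=> x0; rewrite /munion natr_sum (eq_bigr _ (fun i _ => beatty_saw (a0 i) (irr i) x0)).
  by rewrite big_split big_split /= sumrN am.
split=> [[N hN]|[C [N hN]]].
  exists (S N.+1), N.+1 => x; elim: x => // x IH; rewrite ltnS leq_eqVlt => /predU1P [<-//|Nx].
  rewrite -(IH Nx) -[LHS]/(S x.+1) -[RHS]/(S x); have := key x ltac:(lia).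
  by rewrite (hN x (ltnW Nx)); lra.
exists N.+1 => x Nx; have := key x ltac:(lia).
rewrite /S !hN ?addrK; [|lia|lia].
by move/eqP; rewrite eqr_nat => /eqP.
Qed.

End Counting.

(** * From lists of pairs to permutations, and the equivalence *)

Lemma sum_ord_pairs (R : nmodType) (G : nat -> R) l :
  \sum_(i < 2 * l) G i = \sum_(h < l) (G (2 * h)%N + G (2 * h + 1)%N).
Proof.
elim: l => [|l IH]; first by rewrite !big_ord0.
by rewrite mulnS addnC addn2 !big_ord_recr /= IH addn1 addrA.
Qed.

Lemma nth_flatten_pairs (T : Type) (x0 : T) (p : seq (T * T)) h :
  nth x0 (flatten [seq [:: u.1; u.2] | u <- p]) (2 * h) = (nth (x0, x0) p h).1 /\
  nth x0 (flatten [seq [:: u.1; u.2] | u <- p]) (2 * h + 1) = (nth (x0, x0) p h).2.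
Proof.
elim: p h => [|u p IH] [|h]; rewrite ?nth_nil//.
by rewrite mulnS /=; have := IH h.
Qed.

(* With 0-based indices, the paired entries are those at positions
   2h and 2h + 1 of the re-ordered family, for h < l. *)
Theorem theorem1p8 (R : realType) (m k : nat) (alpha : 'I_k -> R)
    (m_gt0 : (0 < m)%N)
    (alpha_gt0 : forall i : 'I_k, 0 < alpha i)
    (alpha_irr : forall i : 'I_k, irrational (alpha i))
    (sum_alpha : \sum_(i < k) (alpha i)^-1 = m%:R) :
  is_EEC m (fun i : 'I_k => beatty (alpha i) 0) <->
  exists l : nat, k = (2 * l)%N /\
    exists s : {perm 'I_k}, forall (h : nat) (i j : 'I_k),
      (h < l)%N -> nat_of_ord i = (2 * h)%N -> nat_of_ord j = (2 * h + 1)%N ->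
      (alpha (s i))^-1 + (alpha (s j))^-1 \is a Num.int.
Proof.
rewrite is_EEC_saw//; split=> [const|[l [kl [s hs]]]].
  pose t := [tuple (alpha i)^-1 | i < k].
  have [||p pt hp] := @complementary_pairs R t.
  - by move=> a /mapP [i _ ->]; apply: no_int_multipleV.
  - have [C [N hC]] := const; exists C, N => x /hC <-.
    by rewrite big_map big_enum.
  have pk : k = (2 * size p)%N.
    have := perm_size pt; rewrite size_tuple => <-.
    by rewrite size_flatten /shape -map_comp; elim: (p) => //= u q ->; lia.
  exists (size p); split=> //.
  (* The permutation that lists the reciprocals pair after pair. *)
  have [s hs] := tuple_permP pt; exists s => h i j hl hi hj.
  have val_s (j' : 'I_k) : (alpha (s j'))^-1 = nth 0 (flatten [seq [:: u.1; u.2] | u <- p]) j'.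
    by rewrite hs -tnth_nth tnth_mktuple tnth_mktuple.
  have [e1 e2] := nth_flatten_pairs (0 : R) p h.
  by rewrite !val_s hi hj e1 e2; apply/hp/mem_nth.
exists 0, 1%N => x x0; rewrite (reindex_inj (@perm_inj _ s)) /=.
(* [G] extends the summand to all naturals; its default 0 is never reached, since [2 h] and
   [2 h + 1] are below [k]. *)
pose G (n : nat) : R :=
  oapp (fun i : 'I_k => saw (x%:R * (alpha (s i))^-1)) 0 (insub n).
rewrite (eq_bigr (fun i : 'I_k => G i)) => [|i _]; last by rewrite /G valK.
rewrite [in LHS]kl sum_ord_pairs big1// => h _.
have h1 : (2 * h < k)%N by rewrite kl; have := ltn_ord h; lia.
have h2 : (2 * h + 1 < k)%N by rewrite kl; have := ltn_ord h; lia.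
rewrite /G (insubT (fun n => n < k)%N h1) (insubT (fun n => n < k)%N h2) /=.
apply: saw_complement => //; first exact: no_int_multipleV.
exact: (hs h).
Qed.
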